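(* Let $V$ be a connected braided vector space of diagonal type with canonical basis $x_1,\dots,x_n$ over a field $F$ of characteristic zero. Let $D$ be the set of hard super-letters of the Nichols algebra $\mathfrak B(V)$, let $D^-=\{[u]^-\mid [u]\in D\}$ and $\deg(D^-)=\{\deg([u]^-)\mid [u]\in D\}$, and let $\mathfrak L^-(V)$ be the Nichols Lie algebra of $V$. Then: (i) $\dim \mathfrak L^-(V)\ \ge\ |\deg(D^-)|-1\ \ge\ n+E_e-1$, where $E_e$ is the number of edges in the generalized Dynkin diagram of $V$. (ii) If $D^-$ is infinite, then $\dim\mathfrak L^-(V)=\infty$.
   Context: $F$ is a field of characteristic zero. $V$ is a braided vector space of diagonal type: it has a basis $x_1,\dots,x_n$ (canonical basis) and braiding $C(x_i\otimes x_j)=p_{ij}\,x_j\otimes x_i$ with $p_{ij}\in F\setminus\{0\}$. Its generalized Dynkin diagram has vertices $1,\dots,n$ and an edge between $i\ne j$ iff $p_{ij}p_{ji}\neq1$; $V$ is connected if this graph is connected (standing assumption). Nichols algebra: $\mathfrak B(V)=T(V)/\bigoplus_{m\ge2}\ker S_m$, where $S_m\in \mathrm{End}(V^{\otimes m})$ is $S_m=\prod_{j=1}^{m-1}(\mathrm{id}^{\otimes (m-j-1)}\otimes S_{1,j})$ (factors in order of increasing $j$ from left to right), $S_{1,j}=\mathrm{id}+C_{12}^{-1}+C_{12}^{-1}C_{23}^{-1}+\cdots+C_{12}^{-1}C_{23}^{-1}\cdots C_{j,j+1}^{-1}$. It is $\mathbb Z^n$-graded with $\deg x_i=e_i$ (standard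 basis vector). Let $\chi$ be the bicharacter on $\mathbb Z^n$ with $\chi(e_i,e_j)=p_{ij}$; for homogeneous elements (or words) $u,v$ put $p_{uv}=\chi(\deg u,\deg v)$. Nichols Lie algebra: $\mathfrak L^-(V)$ is the Lie subalgebra of $\mathfrak B(V)$ generated by $V$ under $[x,y]^-=xy-yx$. Words and super-letters: on words in the alphabet $x_1<\dots<x_n$ use the lexicographic order (a proper prefix is smaller). A non-empty word $u$ is a Lyndon word if $|u|=1$, or $|u|\ge2$ and $u<u_2u_1$ for every factorization $u=u_1u_2$ into non-empty words. If $u$ is Lyndon with $|u|>1$, its Shirshov decomposition is $u=vw$ with $v,w$ Lyndon and $v$ shortest. For Lyndon $u$ define inductively elements of $\mathfrak B(V)$: $[u]=[u]^-=u$ if $u$ is a letter; otherwise, with Shirshov decomposition $u=vw$, $[u]=[w][v]-p_{wv}[v][w]$ and $[u]^-=[w]^-[v]^--[v]^-[w]^-$. The elements $[u]$, $u$ Lyndon, are the super-letters, ordered by $[u]<[v]$ iff $u<v$. A super-letter $[u]$ is hard if it is not a linear combination of products $[u_1]\cdots[u_i]$, $i\in\mathbb N$, of super-letters with $[u]<[u_j]$ for all $j$. $D$ is the set of hard super-letters. If $[u]^-=0$ for some $[u]\in D$, the degree of the zero element is counted as one single (formal) value in $\deg(D^-)$. *)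

(* Defs.v *)
From HB Require Import structures.
From mathcomp Require Import all_boot all_order all_algebra finmap.
From mathcomp Require Import generic_quotient ring_quotient.
From mathcomp Require Import monalg.
From mathcomp Require Import boolp classical_sets cardinality constructive_ereal.

Set Implicit Arguments.
Unset Strict Implicit.
Unset Printing Implicit Defensive.

Import Order.TTheory GRing.Theory Num.Theory.

Local Open Scope classical_set_scope.
Local Open Scope ring_scope.

(* Cardinalities and dimensions take values in [\bar int], where all infinite
   cardinals are identified with [+oo]. *)

Definition ecard (T : choiceType) (A : set T) : \bar int :=
  if `[< finite_set A >] then (#|` fset_set A|%:Z)%:E else +oo%E.

Section LinearAlgebra.
Variables (F : fieldType) (V : lmodType F).

Definition lspan (A : set V) : set V :=
  [set v | exists (k : nat) (c : 'I_k -> F) (b : 'I_k -> V),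
     (forall i, A (b i)) /\ v = \sum_i c i *: b i].

Definition has_basis_of_size (W : set V) (k : nat) : Prop :=
  exists b : 'I_k -> V,
    [/\ forall i, W (b i),
        forall c : 'I_k -> F, \sum_i c i *: b i = 0 -> forall i, c i = 0
      & W `<=` lspan (range b)].

Definition edim (W : set V) : \bar int :=
  if `[< exists k, has_basis_of_size W k >]
  then ((xget 0%N [set k | has_basis_of_size W k])%:Z)%:E else +oo%E.

End LinearAlgebra.

Section Lie.
Variables (F : fieldType) (A : lalgType F).

Definition lie_bracket (x y : A) : A := x * y - y * x.

Definition lie_subalgebra (L : set A) : Prop :=
  [/\ L 0,
      forall (c : F) (x y : A), L x -> L y -> L (c *: x + y)
    & forall x y : A, L x -> L y -> L (lie_bracket x y)].

End Lie.

Notation word n := (seq 'I_n).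

Notation tensor_alg F n := {malg F[{fmonom 'I_n}]}.

Section TensorAlgebra.
Variables (F : fieldType) (n : nat).
Local Notation T := (tensor_alg F n).

Definition tword (w : word n) : T := << FMonom w >>.

Definition lin_ext (V : lmodType F) (f : word n -> V) (t : T) : V :=
  \sum_(w <- msupp t) t@_w *: f w.

(* The component of [t] in the summand of [T(V)] of tensor degree [m]. *)
Definition tcomp (m : nat) (t : T) : T :=
  lin_ext (fun w => if size w == m then tword w else 0) t.

Lemma lin_extEw (V : lmodType F) (f : word n -> V) (d : {fset {fmonom 'I_n}})
  (t : T) : (msupp t `<=` d)%fset -> lin_ext f t = \sum_(w <- d) t@_w *: f w.
Proof.
move=> le; rewrite /lin_ext (big_fset_incl _ le) //= => w _.
by move/mcoeff_outdom=> ->; rewrite scale0r.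
Qed.

Lemma lin_ext_is_linear (V : lmodType F) (f : word n -> V) : linear (lin_ext f).
Proof.
move=> c s t; pose d := (msupp s `|` msupp t `|` msupp (c *: s + t))%fset.
rewrite !(@lin_extEw _ _ d) /d ?fsubsetUr //; first last.
- by rewrite -fsetUA fsubsetUl.
- by rewrite fsetUAC fsubsetUr.
rewrite scaler_sumr -big_split; apply: eq_bigr => w _ /=.
by rewrite mcoeffD mcoeffZ scalerDl scalerA.
Qed.

HB.instance Definition _ (V : lmodType F) (f : word n -> V) :=
  GRing.isLinear.Build F T V *:%R (lin_ext f) (lin_ext_is_linear f).

HB.instance Definition _ m := GRing.Linear.copy (tcomp m)
  (lin_ext (fun w => if size w == m then tword w else 0)).

Lemma lin_ext_word (V : lmodType F) (f : word n -> V) w :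
  lin_ext f (tword w) = f w.
Proof.
by rewrite /lin_ext /tword msuppU1 big_seq_fset1 mcoeffUU scale1r.
Qed.

Lemma twordM v w : tword v * tword w = tword (v ++ w).
Proof. by rewrite /tword malgM_def fgmulUU mulr1 -(fmmulE (FMonom v) (FMonom w)). Qed.

Lemma tword_nil : tword [::] = 1.
Proof. by rewrite /tword -fmoneE. Qed.

Lemma coef_tword v w : (tword v)@_(FMonom w) = (v == w)%:R.
Proof. by rewrite /tword mcoeffU1. Qed.

Lemma tens_expand (t : T) : t = lin_ext tword t.
Proof.
rewrite {1}[t]monalgE; apply: eq_bigr => w _.
apply/malgP => k; rewrite mcoeffZ !mcoeffU.
by rewrite fmK mulrnAr mulr1.
Qed.

Lemma tens_ext (V : lmodType F) (f g : {linear T -> V}) :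
  (forall w, f (tword w) = g (tword w)) -> f =1 g.
Proof.
move=> fg t; rewrite [t]tens_expand /lin_ext !linear_sum.
by apply: eq_bigr => w _; rewrite !linearZ /= fg.
Qed.

End TensorAlgebra.

Section Braiding.
Variables (F : fieldType) (n : nat) (p : 'M[F]_n).
Local Notation T := (tensor_alg F n).
Implicit Types (t : T) (w : word n).

(* [braid k] and [braid_inv k] are C and C^-1 acting on the tensor factors
   number [k] and [k.+1], counted from 0; they fix the words too short to have
   such factors, on which they are never used. *)
Definition braid_word (k : nat) w : T :=
  if drop k w is i :: j :: s then p i j *: tword F (take k w ++ [:: j, i & s])
  else tword F w.

Definition braid_inv_word (k : nat) w : T :=
  if drop k w is i :: j :: s
  then (p j i)^-1 *: tword F (take k w ++ [:: j, i & s])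
  else tword F w.

Definition braid (k : nat) : T -> T := lin_ext (braid_word k).
Definition braid_inv (k : nat) : T -> T := lin_ext (braid_inv_word k).

(* id^{(x) s} (x) S_{1,j}; the [k]-th summand is the composite
   C^-1_{s+1,s+2} o ... o C^-1_{s+k,s+k+1}, its rightmost factor acting first *)
Definition S1 (s j : nat) t : T :=
  \sum_(k < j.+1) foldr (fun l => braid_inv (s + l)) t (iota 0 k).

(* S_m = \prod_{j=1}^{m-1} (id^{(x) (m-j-1)} (x) S_{1,j}), the factor j = m-1
   acting first *)
Definition Sym (m : nat) t : T :=
  foldr (fun j => S1 (m - j - 1) j) t (iota 1 m.-1).

(* The direct sum of the kernels of the [Sym m] on tensor degree [m], [2 <= m] *)
Definition nichols_rel t : Prop :=
  forall m, if (2 <= m)%N then Sym m (tcomp m t) = 0 else tcomp m t = 0.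

HB.instance Definition _ k := GRing.Linear.copy (braid k)
  (lin_ext (braid_word k)).
HB.instance Definition _ k := GRing.Linear.copy (braid_inv k)
  (lin_ext (braid_inv_word k)).

Lemma braid_tword a i j s : braid (size a) (tword F (a ++ [:: i, j & s])) =
  p i j *: tword F (a ++ [:: j, i & s]).
Proof.
rewrite /braid lin_ext_word /braid_word.
by rewrite (drop_size_cat _ (erefl _)) (take_size_cat _ (erefl _)).
Qed.

Lemma braid_inv_tword a i j s :
  braid_inv (size a) (tword F (a ++ [:: i, j & s])) =
  (p j i)^-1 *: tword F (a ++ [:: j, i & s]).
Proof.
rewrite /braid_inv lin_ext_word /braid_inv_word.
by rewrite (drop_size_cat _ (erefl _)) (take_size_cat _ (erefl _)).
Qed.

Lemma braid_short k w : (size w <= k.+1)%N ->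
  braid k (tword F w) = tword F w /\ braid_inv k (tword F w) = tword F w.
Proof.
move=> kw; have : (size (drop k w) <= 1)%N by rewrite size_drop leq_subLR addn1.
rewrite /braid /braid_inv !lin_ext_word /braid_word /braid_inv_word.
by case: (drop k w) => [|i [|j s]].
Qed.

Lemma long_wordP k w : (k.+1 < size w)%N ->
  exists a i j s, k = size a /\ w = a ++ [:: i, j & s].
Proof.
move=> kw; have : (1 < size (drop k w))%N by rewrite size_drop ltn_subRL addn1.
case E: (drop k w) => [|i [|j s]] // _; exists (take k w), i, j, s.
by rewrite size_takel 1?ltnW 1?ltnW // -E cat_take_drop.
Qed.

Lemma braid_invK k : (forall i j, p i j != 0) -> cancel (braid_inv k) (braid k).
Proof.
move=> p0 t.
apply: (tens_ext (f := braid k \o braid_inv k) (g := idfun)) => w.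
rewrite [LHS]/=; case: (leqP (size w) k.+1) => [/braid_short[e1 ->] //|].
case/long_wordP => a [i [j [s [-> ->]]]].
rewrite braid_inv_tword (linearZ_LR (braid (size a))) [LHS]/= braid_tword.
by rewrite scalerA mulVf // scale1r.
Qed.

Lemma braidK k : (forall i j, p i j != 0) -> cancel (braid k) (braid_inv k).
Proof.
move=> p0 t.
apply: (tens_ext (f := braid_inv k \o braid k) (g := idfun)) => w.
rewrite [LHS]/=; case: (leqP (size w) k.+1) => [/braid_short[-> e1] //|].
case/long_wordP => a [i [j [s [-> ->]]]].
rewrite braid_tword (linearZ_LR (braid_inv (size a))) [LHS]/= braid_inv_tword.
by rewrite scalerA mulfV // scale1r.
Qed.

End Braiding.

(* [nichols_rel p] is a two-sided ideal: it consists of the elements killed by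
   all products of the skew derivations [der i] followed by the augmentation.
   This is proved for an abstract algebra with a basis indexed by words. *)
Module SkewDerivations.
Section SkewDerivations.
Variables (F : fieldType) (n : nat) (p : 'M[F]_n) (A : lalgType F).
Hypothesis mul_scaler : forall (a b : A) (c : F), a * (c *: b) = c *: (a * b).
Variable X : word n -> A.
Hypothesis X_nil : X [::] = 1.
Hypothesis XM : forall v w, X v * X w = X (v ++ w).
Hypothesis X_ext : forall (V : lmodType F) (f g : {linear A -> V}),
  (forall w, f (X w) = g (X w)) -> f =1 g.
Variable coef : word n -> {linear A -> F^o}.
Hypothesis coefX : forall u w, coef u (X w) = (u == w)%:R.
Hypothesis coef_inj : forall t, (forall u, coef u t = 0) -> t = 0.
Variable comp : nat -> {linear A -> A}.
Hypothesis compX : forall m w, comp m (X w) = if size w == m then X w else 0.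
Variable binv : nat -> {linear A -> A}.
Hypothesis binvX : forall a i j s,
  binv (size a) (X (a ++ [:: i, j & s])) = (p j i)^-1 *: X (a ++ [:: j, i & s]).
Variables der twist : 'I_n -> {linear A -> A}.
Hypothesis der_nil : forall i, der i (X [::]) = 0.
Hypothesis der_cons : forall i j w, der i (X (j :: w)) =
  (i == j)%:R *: X w + (p i j)^-1 *: (X [:: j] * der i (X w)).
Hypothesis twistX : forall i w,
  twist i (X w) = (\prod_(j <- w) (p i j)^-1) *: X w.

Definition lmul (a b : A) : A := a * b.
Lemma lmul_is_linear a : linear (lmul a).
Proof. by move=> c s t; rewrite /lmul mulrDr mul_scaler. Qed.
HB.instance Definition _ a :=
  GRing.isLinear.Build F A A *:%R (lmul a) (lmul_is_linear a).

Lemma twist_XM i v t :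
  twist i (X v * t) = (\prod_(j <- v) (p i j)^-1) *: (X v * twist i t).
Proof.
pose c := \prod_(j <- v) (p i j)^-1.
apply: (X_ext (f := twist i \o lmul (X v))
                 (g := c \*: (lmul (X v) \o twist i))) => w /=.
by rewrite /lmul XM !twistX mul_scaler XM scalerA big_cat.
Qed.

Lemma der_XM1 i j s : der i (X [:: j] * s) =
  (i == j)%:R *: s + (p i j)^-1 *: (X [:: j] * der i s).
Proof.
apply: (X_ext (f := der i \o lmul (X [:: j]))
    (g := ((i == j)%:R \*: idfun) \+
       ((p i j)^-1 \*: (lmul (X [:: j]) \o der i)))) => w /=.
by rewrite /lmul XM der_cons.
Qed.

Lemma der_XM i v t :
  der i (X v * t) = der i (X v) * t + twist i (X v) * der i t.
Proof.
elim: v t => [|j v IHv] t.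
  by rewrite der_nil mul0r add0r twistX big_nil scale1r X_nil !mul1r.
have -> : X (j :: v) = X [:: j] * X v by rewrite XM.
rewrite -mulrA !der_XM1 IHv mulrDr scalerDr addrA mulrDl -!scalerAl -!mulrA.
congr (_ + _); rewrite twist_XM big_seq1.
by rewrite -!scalerAl !mulrA.
Qed.

Lemma derM i s t : der i (s * t) = der i s * t + twist i s * der i t.
Proof.
pose r (b a : A) := a * b.
have rl b : linear (r b) by move=> c x y; rewrite /r mulrDl scalerAl.
pose R b := HB.pack_for {linear A -> A} (r b)
  (GRing.isLinear.Build F A A *:%R (r b) (rl b)).
apply: (X_ext (f := der i \o R t)
  (g := (R t \o der i) \+ (R (der i t) \o twist i))) => w /=.
exact: der_XM.
Qed.

Lemma der_twist i j t : der j (twist i t) = (p i j)^-1 *: twist i (der j t).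
Proof.
apply: (X_ext (f := der j \o twist i)
   (g := (p i j)^-1 \*: (twist i \o der j))) => w /=.
elim: w => [|h w IHw].
  by rewrite twistX linearZ /= der_nil (linear0 (twist i)) !scaler0.
rewrite twistX linearZ /= !der_cons (linearD (twist i)) !(linearZ_LR (twist i)) /= twist_XM.
rewrite !big_cons big_nil mulr1 !scalerDr.
have {}IHw : (\prod_(j0 <- w) (p i j0)^-1) *: der j (X w) =
   (p i j)^-1 *: twist i (der j (X w)).
  by rewrite -IHw twistX linearZ.
congr (_ + _).
  rewrite !scalerA; case: eqP => [<-|_]; last by rewrite !mulr0 !scale0r.
  by rewrite twistX !mulr1 scalerA.
transitivity ((p i h)^-1 *: ((p j h)^-1 *:
   (X [:: h] * ((\prod_(j0 <- w) (p i j0)^-1) *: der j (X w))))).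
  by rewrite mul_scaler !scalerA; congr (_ *: _); rewrite mulrAC.
by rewrite IHw mul_scaler !scalerA; congr (_ *: _); rewrite mulrC mulrCA mulrC -mulrA.
Qed.

Local Notation eps := (coef [::]).

Lemma epsM s t : eps (s * t) = eps s * eps t.
Proof.
pose r (b a : A) := a * b.
have rl b : linear (r b) by move=> c x y; rewrite /r mulrDl scalerAl.
pose R b := HB.pack_for {linear A -> A} (r b)
  (GRing.isLinear.Build F A A *:%R (r b) (rl b)).
transitivity (eps t * eps s); last by rewrite mulrC.
apply: (X_ext (f := eps \o R t) (g := eps t \*: eps)) => v /=.
apply: etrans (mulrC _ _).
apply: (X_ext (f := eps \o lmul (X v)) (g := eps (X v) \*: eps)) => w /=.
by rewrite /lmul XM !coefX; case: v w => [|i v] [|j w] /=;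
  rewrite /GRing.scale /= ?mul1r ?mul0r.
Qed.

Lemma eps_twist i t : eps (twist i t) = eps t.
Proof.
apply: (X_ext (f := eps \o twist i) (g := eps)) => w /=.
rewrite twistX linearZ /= coefX; case: w => [|j w]; last exact: mulr0.
by rewrite big_nil; exact: mul1r.
Qed.

Definition ders (u : word n) (t : A) : A := foldl (fun s i => der i s) t u.

Lemma ders_is_linear u : linear (ders u).
Proof. by move=> c s t; elim: u s t => //= i u IHu s t; rewrite linearP IHu. Qed.
HB.instance Definition _ u :=
  GRing.isLinear.Build F A A *:%R (ders u) (ders_is_linear u).

Definition in_rel t := forall u, eps (ders u t) = 0.

Lemma in_rel_linear c s t : in_rel s -> in_rel t -> in_rel (c *: s + t).
Proof.
move=> hs ht u; rewrite (linearP (ders u)) (linearP eps) hs ht.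
by rewrite addr0; apply: mulr0.
Qed.

Lemma in_rel0 : in_rel 0.
Proof. by move=> u; rewrite (linear0 (ders u)) linear0. Qed.

Lemma in_rel_twist i t : in_rel t -> in_rel (twist i t).
Proof.
move=> Ht v; elim: v t Ht => [|j v IHv] t Ht /=.
  by rewrite eps_twist; apply: (Ht [::]).
rewrite der_twist [ders _ _]linearZ linearZ /= IHv ?mulr0 //; last first.
  by move=> u; apply: (Ht (j :: u)).
by apply: mulr0.
Qed.

Lemma in_relM s t : in_rel s \/ in_rel t -> in_rel (s * t).
Proof.
move=> st u; elim: u s t st => [|i u IHu] s t st /=.
  by rewrite epsM; case: st => /(_ [::]) /= ->; rewrite ?mul0r ?mulr0.
rewrite derM [ders _ _]linearD linearD; case: st => [Hs|Ht].
- rewrite (IHu (der i s)); last by left=> v; apply: (Hs (i :: v)).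
  by rewrite IHu ?addr0 //; left; apply: in_rel_twist.
- rewrite (IHu (der i s)); last by right.
  by rewrite IHu ?addr0 //; right=> v; apply: (Ht (i :: v)).
Qed.

Fixpoint Rm m (t : A) : A :=
  if m is m'.+1 then \sum_i X [:: i] * Rm m' (der i t) else t.

Lemma Rm_is_linear m : linear (Rm m).
Proof.
elim: m => [|m IHm] c s t //=.
rewrite scaler_sumr -big_split; apply: eq_bigr => i _ /=.
by rewrite linearP IHm mulrDr mul_scaler.
Qed.
HB.instance Definition _ m :=
  GRing.isLinear.Build F A A *:%R (Rm m) (Rm_is_linear m).

Lemma comp_XM i m t : comp m.+1 (X [:: i] * t) = X [:: i] * comp m t.
Proof.
apply: (X_ext (f := comp m.+1 \o lmul (X [:: i]))
  (g := lmul (X [:: i]) \o comp m)) => w /=.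
by rewrite /lmul XM !compX /= eqSS; case: eqP; rewrite ?mulr0 ?XM.
Qed.

Lemma comp_XM0 i t : comp 0 (X [:: i] * t) = 0.
Proof.
apply: (X_ext (f := comp 0 \o lmul (X [:: i])) (g := GRing.Linear.clone F A A *:%R (fun _ => 0) \0)) => w /=.
by rewrite /lmul XM compX.
Qed.

Lemma der_comp i m t : der i (comp m.+1 t) = comp m (der i t).
Proof.
apply: (X_ext (f := der i \o comp m.+1) (g := comp m \o der i)) => w /=.
elim: w m => [|j w IHw] m; first by rewrite compX /= der_nil !linear0.
rewrite der_cons linearD !linearZ /= compX /= eqSS.
case: m => [|m].
  rewrite comp_XM0 scaler0 addr0 compX; case: w {IHw} => [|k w] /=.
    by rewrite der_cons der_nil mulr0 !scaler0 addr0.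
  by rewrite linear0 ?scaler0.
rewrite comp_XM -IHw !compX; case: eqP => _; first by rewrite der_cons.
by rewrite linear0 mulr0 !scaler0 addr0.
Qed.

Lemma Rm_comp m t : comp m (Rm m t) = Rm m (comp m t).
Proof.
elim: m t => [|m IHm] t //=.
rewrite linear_sum; apply: eq_bigr => i _ /=.
by rewrite comp_XM IHm der_comp.
Qed.

Lemma comp_idem m t : comp m (comp m t) = comp m t.
Proof.
apply: (X_ext (f := comp m \o comp m) (g := comp m)) => w /=.
by rewrite compX; case: eqP => [e|_]; rewrite ?linear0 // compX e eqxx.
Qed.

Lemma coef_XM i u j t : coef (i :: u) (X [:: j] * t) = (i == j)%:R * coef u t.
Proof.
apply: (X_ext (f := coef (i :: u) \o lmul (X [:: j]))
  (g := (i == j)%:R \*: coef u)) => w /=.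
rewrite /lmul XM !coefX eqseq_cons.
by case: eqP => _; [rewrite /= /GRing.scale /= mul1r | rewrite /= scale0r].
Qed.

Lemma coef_Rm u t : coef u (Rm (size u) t) = eps (ders u t).
Proof.
elim: u t => [|i u IHu] t //=.
rewrite linear_sum (bigD1 i) //= big1 ?addr0 => [|j /negPf ji].
  by rewrite coef_XM eqxx mul1r.
by rewrite coef_XM eq_sym ji mul0r.
Qed.

Lemma coef_comp u m t : coef u (comp m t) = (size u == m)%:R * coef u t.
Proof.
apply: (X_ext (f := coef u \o comp m) (g := (size u == m)%:R \*: coef u)) => w /=.
rewrite compX coefX /GRing.scale /=.
case: (eqVneq u w) => [<-|uw]; last first.
  by rewrite mulr0; case: eqP => _; rewrite ?linear0 // coefX (negPf uw).
by case: eqP => _; rewrite ?linear0 ?mul0r // coefX eqxx mulr1.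
Qed.

Lemma ders_comp u t : eps (ders u (comp (size u) t)) = eps (ders u t).
Proof.
elim: u t => [|i u IHu] t /=; first by rewrite coef_comp eqxx mul1r.
by rewrite der_comp IHu.
Qed.

Lemma in_relP t : (forall m, Rm m (comp m t) = 0) <-> in_rel t.
Proof.
split=> [H u|H m].
  by rewrite -ders_comp -coef_Rm H linear0.
apply: coef_inj => u; rewrite -Rm_comp coef_comp.
by case: eqP => [<-|_]; rewrite ?mul0r // coef_Rm H mulr0.
Qed.

Let S1' (s j : nat) (t : A) : A :=
  \sum_(k < j.+1) foldr (fun l => binv (s + l)) t (iota 0 k).
Let Sym' (m : nat) (t : A) : A :=
  foldr (fun j => S1' (m - j - 1) j) t (iota 1 m.-1).

Lemma iotaS_rcons m k : iota m k.+1 = rcons (iota m k) (m + k)%N.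
Proof. by rewrite -addn1 iotaD cats1. Qed.

Lemma foldr_binv l a i r :
  foldr (fun k => binv (size l + k)) (X (l ++ a ++ i :: r)) (iota 0 (size a)) =
  (\prod_(j <- a) (p i j)^-1) *: X (l ++ i :: a ++ r).
Proof.
have fZ (c : F) t s : foldr (fun k => binv (size l + k)) (c *: t) s =
   c *: foldr (fun k => binv (size l + k)) t s.
  by elim: s => //= k s ->; rewrite linearZ.
elim/last_ind: a r => [|a j IHa] r /=; first by rewrite big_nil scale1r.
rewrite size_rcons iotaS_rcons add0n foldr_rcons /= -size_cat.
rewrite -cats1 -!catA !cat1s catA binvX -catA fZ (IHa (j :: r)).
by rewrite scalerA big_cat big_seq1 /= mulrC.
Qed.

Lemma sum_binv l a w :
  \sum_(k < size w)
    foldr (fun k => binv (size l + k)) (X (l ++ a ++ w)) (iota 0 (size a + k)) =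
  X l * \sum_i (\prod_(j <- a) (p i j)^-1) *: (X [:: i] * (X a * der i (X w))).
Proof.
elim: w a => [|h w IHw] a.
  by rewrite big_ord0 big1 ?mulr0 // => i _; rewrite der_nil !mulr0 scaler0.
rewrite /= big_ord_recl /= addn0 foldr_binv.
have E k : (size a + bump 0 k = size (rcons a h) + k)%N.
  by rewrite size_rcons addnS. 
rewrite [X in _ + X](_ : _ = \sum_(k < size w)
    foldr (fun k => binv (size l + k)) (X (l ++ a ++ h :: w))
      (iota 0 (size (rcons a h) + k))); last first.
  by apply: eq_bigr => k _; rewrite -E.
have -> : a ++ h :: w = rcons a h ++ w by rewrite cat_rcons.
rewrite IHw; set Y := \sum_i _; set Z := \sum_i _.
have -> : X (l ++ h :: a ++ w) = X l * (X [:: h] * (X a * X w)) by rewrite !XM.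
rewrite -mul_scaler -mulrDr; congr (_ * _).
have -> : (\prod_(j <- a) (p h j)^-1) *: (X [:: h] * (X a * X w)) =
  \sum_i (\prod_(j <- a) (p i j)^-1) *:
      (X [:: i] * (X a * ((i == h)%:R *: X w))).
  rewrite (bigD1 h) //= eqxx scale1r [X in _ + X]big1 ?addr0 // => i /negPf ->.
  by rewrite scale0r !mulr0 scaler0.
rewrite -big_split; apply: eq_bigr => i _ /=.
rewrite der_cons mulrDr mulrDr scalerDr; congr (_ + _).
rewrite !mul_scaler scalerA -cats1 big_cat big_seq1 /=.
by rewrite -XM -mulrA.
Qed.

Lemma X_comp_ext (f g : {linear A -> A}) m t :
  (forall w, size w = m -> f (X w) = g (X w)) -> f (comp m t) = g (comp m t).
Proof.
move=> fg; apply: (X_ext (f := f \o comp m) (g := g \o comp m)) => w /=.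
by rewrite compX; case: eqP => [/fg//|_]; rewrite !linear0.
Qed.

Lemma S1_is_linear' s j : linear (S1' s j).
Proof.
move=> c t u; rewrite /S1' scaler_sumr -big_split; apply: eq_bigr => k _ /=.
by elim: (iota 0 k) => //= l r ->; rewrite linearP.
Qed.

Lemma foldr_lin (f : nat -> A -> A) r :
  (forall i, linear (f i)) -> linear (fun t => foldr f t r).
Proof. by move=> lf c s t; elim: r => //= i r ->; rewrite lf. Qed.

Let h k (l : word n) t :=
  foldr (fun j => S1' (size l + (k - j - 1)) j) t (iota 1 k.-1).
Lemma h_is_linear k l : linear (h k l).
Proof. by apply: foldr_lin => j; apply: S1_is_linear'. Qed.
HB.instance Definition _ k l :=
  GRing.isLinear.Build F A A *:%R (h k l) (h_is_linear k l).

Lemma h_step m l t : h m.+2 l t =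
  foldr (fun j => S1' ((size l).+1 + (m.+1 - j - 1)) j)
    (S1' (size l) m.+1 t) (iota 1 m).
Proof.
rewrite /h [m.+2.-1]/= iotaS_rcons foldr_rcons add1n.
have -> : (m.+2 - m.+1 - 1 = 0)%N by rewrite subSS subSnn.
rewrite addn0; move: (S1' _ _ t) => y.
have : all (fun j => j <= m)%N (iota 1 m).
  by apply/allP => j; rewrite mem_iota add1n ltnS => /andP[].
elim: (iota 1 m) => //= j r IHr /andP[jm /IHr ->]; congr (S1' _ _ _).
rewrite addSnnS; congr (_ + _)%N.
by rewrite -subnDA addn1 !subSS -subnDA addn1 subSS subSn.
Qed.

Lemma foldr_S1 l m t : h m l (X l * comp m t) = X l * Rm m (comp m t).
Proof.
elim: m l t => [|m IHm] l t //.
apply: (X_comp_ext (f := h m.+1 l \o lmul (X l))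
                   (g := lmul (X l) \o Rm m.+1)) => w sw.
rewrite [LHS]/= [RHS]/= /lmul XM; case: m IHm sw => [|m] IHm sw.
  rewrite /h /= -XM; congr (_ * _); case: w sw => [|i [|]] //= _.
  rewrite (bigD1 i) //= big1 => [|j /negPf ji].
    by rewrite der_cons eqxx der_nil mulr0 scaler0 scale1r X_nil !addr0 mulr1.
  by rewrite der_cons ji der_nil mulr0 scaler0 scale0r addr0 mulr0.
rewrite h_step.
have -> : S1' (size l) m.+1 (X (l ++ w)) =
    \sum_i X (rcons l i) * comp m.+1 (der i (X w)).
  rewrite /S1' -sw; have := sum_binv l [::] w; rewrite /= => ->.
  rewrite mulr_sumr; apply: eq_bigr => i _.
  rewrite big_nil scale1r X_nil mul1r mulrA XM cats1 -der_comp compX sw.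
  by rewrite eqxx.
pose g := foldr (fun j => S1' ((size l).+1 + (m.+1 - j - 1)) j).
have gl r : linear (fun t => g t r).
  by apply: foldr_lin => j; apply: S1_is_linear'.
pose G r := HB.pack_for {linear A -> A} (fun t => g t r)
  (GRing.isLinear.Build F A A *:%R _ (gl r)).
rewrite -[LHS]/(G (iota 1 m) _) linear_sum mulr_sumr; apply: eq_bigr => i _.
have := IHm (rcons l i) (der i (X w)); rewrite /h size_rcons => IH.
rewrite [LHS]IH -cats1 -XM -mulrA; congr (_ * (_ * Rm m.+1 _)).
by rewrite -der_comp compX sw eqxx.
Qed.

Lemma Sym_Rm m t : Sym' m (comp m t) = Rm m (comp m t).
Proof. by have := foldr_S1 [::] m t; rewrite X_nil !mul1r. Qed.

Lemma in_rel_Sym t :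
  (forall m, if (2 <= m)%N then Sym' m (comp m t) = 0 else comp m t = 0)
  <-> in_rel t.
Proof.
split=> [H|/in_relP H]; [apply/in_relP=> m|move=> m].
  by have := H m; rewrite -Sym_Rm; case: m => [|[|m]].
by have := H m; rewrite -Sym_Rm; case: m => [|[|m]].
Qed.

End SkewDerivations.
End SkewDerivations.

Section NicholsIdeal.
Variables (F : fieldType) (n : nat) (p : 'M[F]_n).
Local Notation T := (tensor_alg F n).
Implicit Types (t : T) (w : word n).

Lemma mul_tensr (a b : T) (c : F) : a * (c *: b) = c *: (a * b).
Proof.
apply/malgP => k; rewrite mcoeffZ.
apply: etrans (mcoeffMlw k (fsubset_refl (msupp a)) (msuppZ_le c b)) _.
rewrite (mcoeffMl a b k) !mulr_sumr; apply: eq_bigr => v _.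
rewrite mulr_sumr; apply: eq_bigr => w _.
by rewrite mcoeffZ mulrCA mulrnAr.
Qed.

Definition tcoef w t : F^o := t@_(FMonom w).
Lemma tcoef_is_linear w : linear (tcoef w).
Proof. by move=> c s t; rewrite /tcoef mcoeffD mcoeffZ. Qed.
HB.instance Definition _ w :=
  GRing.isLinear.Build F T F^o *:%R (tcoef w) (tcoef_is_linear w).

Lemma tcoef_word u w : tcoef u (tword F w) = (u == w)%:R.
Proof. by rewrite /tcoef coef_tword eq_sym. Qed.

Lemma tcoef_inj t : (forall w, tcoef w t = 0) -> t = 0.
Proof.
by move=> t0; apply/malgP => w; rewrite mcoeff0 -[w]fmK; exact: t0.
Qed.

Fixpoint der_word (i : 'I_n) w : T :=
  if w is j :: s
  then (i == j)%:R *: tword F s + (p i j)^-1 *: (tword F [:: j] * der_word i s)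
  else 0.
Definition der (i : 'I_n) : T -> T := lin_ext (der_word i).
HB.instance Definition _ i := GRing.Linear.copy (der i) (lin_ext (der_word i)).

Definition twist_word (i : 'I_n) w : T :=
  (\prod_(j <- w) (p i j)^-1) *: tword F w.
Definition twist (i : 'I_n) : T -> T := lin_ext (twist_word i).
HB.instance Definition _ i :=
  GRing.Linear.copy (twist i) (lin_ext (twist_word i)).

Lemma tcomp_word m w : tcomp m (tword F w) = if size w == m then tword F w else 0.
Proof. exact: lin_ext_word. Qed.

Lemma der_nil i : der i (tword F [::]) = 0.
Proof. exact: lin_ext_word. Qed.

Lemma der_cons i j w : der i (tword F (j :: w)) =
  (i == j)%:R *: tword F w + (p i j)^-1 *: (tword F [:: j] * der i (tword F w)).
Proof. by rewrite /der !lin_ext_word. Qed.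

Lemma twist_tword i w :
  twist i (tword F w) = (\prod_(j <- w) (p i j)^-1) *: tword F w.
Proof. exact: lin_ext_word. Qed.

Definition der_rel t := forall u, tcoef [::] (SkewDerivations.ders der u t) = 0.

Lemma nichols_relP t : nichols_rel p t <-> der_rel t.
Proof.
exact: (@SkewDerivations.in_rel_Sym F n p T mul_tensr (@tword F n)
  (tword_nil F n) (@twordM F n) (@tens_ext F n)
  (fun w => GRing.Linear.clone F T F^o *:%R (tcoef w) _)
  tcoef_word tcoef_inj
  (fun m => GRing.Linear.clone F T T *:%R (@tcomp F n m) _) tcomp_word
  (fun k => GRing.Linear.clone F T T *:%R (braid_inv p k) _)
  (@braid_inv_tword F n p)
  (fun i => GRing.Linear.clone F T T *:%R (der i) _) der_nil der_cons).
Qed.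

Lemma nichols_relM s t :
  nichols_rel p s \/ nichols_rel p t -> nichols_rel p (s * t).
Proof.
move=> st; apply/nichols_relP.
apply: (@SkewDerivations.in_relM F n p T mul_tensr (@tword F n)
  (tword_nil F n) (@twordM F n) (@tens_ext F n)
  (fun w => GRing.Linear.clone F T F^o *:%R (tcoef w) _)
  tcoef_word
  (fun i => GRing.Linear.clone F T T *:%R (der i) _)
  (fun i => GRing.Linear.clone F T T *:%R (twist i) _)
  der_nil der_cons twist_tword).
by case: st => /nichols_relP; [left | right].
Qed.

Lemma nichols_rel_linear c s t :
  nichols_rel p s -> nichols_rel p t -> nichols_rel p (c *: s + t).
Proof.
move=> /nichols_relP hs /nichols_relP ht; apply/nichols_relP.
exact: (@SkewDerivations.in_rel_linear F n T
  (fun w => GRing.Linear.clone F T F^o *:%R (tcoef w) _)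
  (fun i => GRing.Linear.clone F T T *:%R (der i) _)).
Qed.

Lemma nichols_rel0 : nichols_rel p 0.
Proof.
apply/nichols_relP; exact: (@SkewDerivations.in_rel0 F n T
  (fun w => GRing.Linear.clone F T F^o *:%R (tcoef w) _)
  (fun i => GRing.Linear.clone F T T *:%R (der i) _)).
Qed.

Lemma nichols_rel1 : ~ nichols_rel p 1.
Proof.
move=> /nichols_relP /(_ [::]) /=; rewrite -tword_nil tcoef_word.
by move/eqP; rewrite oner_eq0.
Qed.

Definition nichols_ideal : {pred T} := [pred t | `[< nichols_rel p t >]].

Lemma nichols_idealP t : reflect (nichols_rel p t) (t \in nichols_ideal).
Proof. exact: asboolP. Qed.

Lemma nichols_ideal_zmod : zmod_closed nichols_ideal.
Proof.
split; first exact/nichols_idealP/nichols_rel0.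
move=> s t /nichols_idealP hs /nichols_idealP ht; apply/nichols_idealP.
by rewrite addrC -scaleN1r; exact: nichols_rel_linear.
Qed.
HB.instance Definition _ :=
  GRing.isZmodClosed.Build T nichols_ideal nichols_ideal_zmod.

End NicholsIdeal.

Local Open Scope quotient_scope.

Definition nichols (F : fieldType) (n : nat) (p : 'M[F]_n) : Type :=
  Quotient.quot (nichols_ideal p).
HB.instance Definition _ (F : fieldType) n (p : 'M[F]_n) := Choice.on (nichols p).
HB.instance Definition _ (F : fieldType) n (p : 'M[F]_n) := GRing.Zmodule.on (nichols p).

Section NicholsAlgebra.
Variables (F : fieldType) (n : nat) (p : 'M[F]_n).
Local Notation T := (tensor_alg F n).
Local Notation B := (nichols p).

Definition nichols_pi (t : T) : B := \pi_(Quotient.quot (nichols_ideal p)) t.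
Definition nichols_repr (b : B) : T := repr b.

Lemma nichols_reprK b : nichols_pi (nichols_repr b) = b.
Proof. exact: reprK. Qed.

Lemma nichols_pi_eq s t : nichols_pi s = nichols_pi t <-> nichols_rel p (s - t).
Proof.
split=> [/eqP|/nichols_idealP h].
  by rewrite -Quotient.idealrBE => /nichols_idealP.
by apply/eqP; rewrite -Quotient.idealrBE.
Qed.

Lemma nichols_piB : {morph nichols_pi : s t / s - t}.
Proof. exact: raddfB. Qed.
Lemma nichols_piD : {morph nichols_pi : s t / s + t}.
Proof. exact: raddfD. Qed.

Definition nichols_one : B := nichols_pi 1.
Definition nichols_mul (a b : B) : B :=
  nichols_pi (nichols_repr a * nichols_repr b).
Definition nichols_scale (c : F) (a : B) : B := nichols_pi (c *: nichols_repr a).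

Lemma nichols_reprE t : nichols_rel p (nichols_repr (nichols_pi t) - t).
Proof. by apply/nichols_pi_eq; rewrite nichols_reprK. Qed.

Lemma nichols_piM s t : nichols_pi (s * t) = nichols_mul (nichols_pi s) (nichols_pi t).
Proof.
apply/esym/nichols_pi_eq; set s' := nichols_repr _; set t' := nichols_repr _.
have -> : s' * t' - s * t = 1 *: (s' * (t' - t)) + (s' - s) * t.
  by rewrite scale1r mulrBr mulrBl addrA subrK.
apply: nichols_rel_linear; apply: nichols_relM.
  by right; exact: nichols_reprE.
by left; exact: nichols_reprE.
Qed.

Lemma nichols_piZ c t : nichols_pi (c *: t) = nichols_scale c (nichols_pi t).
Proof.
apply/esym/nichols_pi_eq; rewrite -scalerBr -[_ *: _]addr0.
by apply: nichols_rel_linear; [exact: nichols_reprE | exact: nichols_rel0].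
Qed.

Lemma nichols_mulA : associative nichols_mul.
Proof.
move=> a b c; rewrite -[a]nichols_reprK -[b]nichols_reprK -[c]nichols_reprK.
by rewrite -!nichols_piM mulrA.
Qed.
Lemma nichols_mul1 : left_id nichols_one nichols_mul.
Proof. by move=> a; rewrite -[a]nichols_reprK -nichols_piM mul1r. Qed.
Lemma nichols_mulr1 : right_id nichols_one nichols_mul.
Proof. by move=> a; rewrite -[a]nichols_reprK -nichols_piM mulr1. Qed.
Lemma nichols_mulDl : left_distributive nichols_mul +%R.
Proof.
move=> a b c; rewrite -[a]nichols_reprK -[b]nichols_reprK -[c]nichols_reprK.
by rewrite -nichols_piD -!nichols_piM mulrDl nichols_piD.
Qed.
Lemma nichols_mulDr : right_distributive nichols_mul +%R.
Proof.
move=> a b c; rewrite -[a]nichols_reprK -[b]nichols_reprK -[c]nichols_reprK.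
by rewrite -nichols_piD -!nichols_piM mulrDr nichols_piD.
Qed.
Lemma nichols_one_neq0 : nichols_one != 0.
Proof.
apply/eqP => h; apply: (@nichols_rel1 F n p).
have pi0 : nichols_pi 0 = 0 by rewrite -(subrr 0) nichols_piB subrr.
by rewrite -[1]subr0; apply/nichols_pi_eq; rewrite pi0 -h.
Qed.
HB.instance Definition _ := GRing.Zmodule_isNzRing.Build B nichols_mulA
  nichols_mul1 nichols_mulr1 nichols_mulDl nichols_mulDr nichols_one_neq0.

Lemma nichols_scaleA c d a :
  nichols_scale c (nichols_scale d a) = nichols_scale (c * d) a.
Proof. by rewrite -[a]nichols_reprK -!nichols_piZ scalerA. Qed.
Lemma nichols_scale1 : left_id 1 nichols_scale.
Proof. by move=> a; rewrite -[a]nichols_reprK -!nichols_piZ scale1r. Qed.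
Lemma nichols_scaleDr : right_distributive nichols_scale +%R.
Proof.
move=> c a b; rewrite -[a]nichols_reprK -[b]nichols_reprK.
by rewrite -nichols_piD -!nichols_piZ scalerDr nichols_piD.
Qed.
Lemma nichols_scaleDl a : {morph nichols_scale^~ a : c d / c + d}.
Proof.
move=> c d /=; rewrite -[a]nichols_reprK.
by rewrite -!nichols_piZ scalerDl nichols_piD.
Qed.
HB.instance Definition _ := GRing.Zmodule_isLmodule.Build F B nichols_scaleA
  nichols_scale1 nichols_scaleDr nichols_scaleDl.

Lemma nichols_scalerAl (c : F) (a b : B) : c *: (a * b) = c *: a * b.
Proof.
rewrite -[a]nichols_reprK -[b]nichols_reprK.
rewrite [LHS](_ : _ = nichols_pi (c *: (nichols_repr a * nichols_repr b))).
  by rewrite scalerAl nichols_piM nichols_piZ.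
by rewrite nichols_piZ nichols_piM.
Qed.
HB.instance Definition _ := GRing.Lmodule_isLalgebra.Build F B nichols_scalerAl.

Lemma nichols_scalerAr (c : F) (a b : B) : c *: (a * b) = a * (c *: b).
Proof.
rewrite -[a]nichols_reprK -[b]nichols_reprK.
rewrite [LHS](_ : _ = nichols_pi (c *: (nichols_repr a * nichols_repr b))).
  by rewrite -mul_tensr nichols_piM nichols_piZ.
by rewrite nichols_piZ nichols_piM.
Qed.
HB.instance Definition _ := GRing.Lalgebra_isAlgebra.Build F B nichols_scalerAr.

Lemma nichols_pi_is_linear : linear nichols_pi.
Proof. by move=> c s t; rewrite nichols_piD nichols_piZ. Qed.
HB.instance Definition _ :=
  GRing.isLinear.Build F T B *:%R nichols_pi nichols_pi_is_linear.

Lemma nichols_pi_is_monoid_morphism : monoid_morphism nichols_pi.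
Proof. by split; [exact: erefl | exact: nichols_piM]. Qed.
HB.instance Definition _ :=
  GRing.isMonoidMorphism.Build T B nichols_pi nichols_pi_is_monoid_morphism.

End NicholsAlgebra.

Section Dynkin.
Variables (F : fieldType) (n : nat) (p : 'M[F]_n).

Definition dynkin_edge : rel 'I_n :=
  fun i j => (i != j) && (p i j * p j i != 1).

Definition dynkin_connected : Prop := forall i j, connect dynkin_edge i j.

Definition dynkin_edges : nat :=
  #|[set e : 'I_n * 'I_n | (e.1 < e.2)%N & dynkin_edge e.1 e.2]|.

End Dynkin.

Section Words.
Variable n : nat.
Implicit Types u : word n.

(* A proper prefix is smaller in the order of [seqlexi]. *)
Definition word_lt (u v : word n) : bool := (u < v :> seqlexi 'I_n)%O.

Definition lyndon u : bool :=
  (u != [::]) &&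
  all (fun k => word_lt u (drop k u ++ take k u)) (iota 1 (size u).-1).

(* The length of the left factor of the Shirshov decomposition; the default
   value 1 plays no role for Lyndon words, which have such a decomposition. *)
Definition shirshov_index u : nat :=
  head 1%N [seq k <- iota 1 (size u).-1 | lyndon (take k u) && lyndon (drop k u)].

Definition wdeg u : 'rV[int]_n := \sum_(i <- u) delta_mx 0 i.

End Words.

Section SuperLetters.
Variables (F : fieldType) (n : nat) (p : 'M[F]_n).
Local Notation B := (nichols p).
Implicit Types u v w : word n.

Definition nichols_x (i : 'I_n) : B := nichols_pi p (tword F [:: i]).

Definition bichar (d e : 'rV[int]_n) : F :=
  \prod_i \prod_j p i j ^ (d 0 i * e 0 j).

Fixpoint bracketing_rec (br : word n -> word n -> B -> B -> B) (m : nat) u : B :=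
  match m, u with
  | m'.+1, [:: i] => nichols_x i
  | m'.+1, [:: _, _ & _] =>
      let v := take (shirshov_index u) u in
      let w := drop (shirshov_index u) u in
      br v w (bracketing_rec br m' v) (bracketing_rec br m' w)
  | _, _ => 0
  end.

Definition bracketing (br : word n -> word n -> B -> B -> B) u : B :=
  bracketing_rec br (size u) u.

Definition super_letter : word n -> B :=
  bracketing (fun v w bv bw => bw * bv - bichar (wdeg w) (wdeg v) *: (bv * bw)).

Definition super_letter_minus : word n -> B :=
  bracketing (fun _ _ bv bw => lie_bracket bw bv).

Lemma shirshov_index_bounds u : (1 < size u)%N ->
  (0 < shirshov_index u < size u)%N.
Proof.
move=> su; rewrite /shirshov_index; set s := [seq _ <- _ | _].
have : all (fun k => 0 < k < size u)%N s.
  apply/allP => k; rewrite mem_filter mem_iota add1n => /andP[_].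
  by case: (size u) su.
by case: s => [|k s] /=; [rewrite su | case/andP].
Qed.

Lemma bracketing_letter br i : bracketing br [:: i] = nichols_x i.
Proof. by []. Qed.

Lemma bracketing_cat br u : (1 < size u)%N ->
  let v := take (shirshov_index u) u in
  let w := drop (shirshov_index u) u in
  bracketing br u = br v w (bracketing br v) (bracketing br w).
Proof.
have fuel m k x : (size x <= m)%N -> (size x <= k)%N ->
    bracketing_rec br m x = bracketing_rec br k x.
  elim: m k x => [|m IHm] [|k] [|i [|j x]] //= xm xk.
  have /andP[s0 sx] := @shirshov_index_bounds [:: i, j & x] isT.
  set l := shirshov_index _ in s0 sx *.
  have st : (size (take l [:: i, j & x]) <= (size x).+1)%N.
    by rewrite size_takel; [rewrite -ltnS | apply: ltnW].
  have sd : (size (drop l [:: i, j & x]) <= (size x).+1)%N.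
    rewrite size_drop leq_subLR; move: s0; case: (l) => // l' _.
    by rewrite addSn ltnS leq_addl.
  by congr br; apply: IHm; exact: leq_trans st _ || exact: leq_trans sd _.
move=> su v w; have /andP[s0 sx] := shirshov_index_bounds su.
rewrite /bracketing.
have e : size u = (size u).-1.+1 by rewrite prednK // ltnW.
rewrite {1}e; transitivity (br v w (bracketing_rec br (size u).-1 v)
  (bracketing_rec br (size u).-1 w)); first by rewrite /v /w; case: u su {v w s0 sx e} => [|i [|]].
congr br; apply: fuel => //.
  by rewrite -ltnS -e size_takel // ltnW.
by rewrite size_drop -ltnS -e ltn_subrL s0 ltnW.
Qed.

(* Super-letters are represented by their Lyndon words. *)
Definition hard u : Prop :=
  lyndon u /\
  ~ lspan [set \prod_(v <- us) super_letter v
          | us in [set us : seq (word n) | all (fun v => lyndon v && word_lt u v) us]]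
      (super_letter u).

Definition D_minus : set B := [set super_letter_minus u | u in [set u | hard u]].

Definition homogeneous (d : 'rV[int]_n) (b : B) : Prop :=
  exists2 t : tensor_alg F n,
    forall w, FMonom w \in msupp t -> wdeg w = d & b = nichols_pi p t.

(* [None] is the formal degree of the zero element. *)
Definition has_degree (b : B) (o : option 'rV[int]_n) : Prop :=
  if o is Some d then b <> 0 /\ homogeneous d b else b = 0.

Definition deg_D_minus : set (option 'rV[int]_n) :=
  [set o | exists2 u, hard u & has_degree (super_letter_minus u) o].

Definition nichols_V : set B := lspan (range nichols_x).

Definition nichols_lie : set B := smallest (@lie_subalgebra F B) nichols_V.

End SuperLetters.

Arguments nichols_x {F n} p i.
Arguments super_letter {F n} p u.
Arguments super_letter_minus {F n} p u.
Arguments D_minus {F n} p.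
Arguments nichols_V {F n} p.
Arguments nichols_lie {F n} p.

(* Main.v *)
From HB Require Import structures.
Require Import Defs.
From mathcomp Require Import all_boot all_order all_algebra finmap.
From mathcomp Require Import monalg.
From mathcomp Require Import boolp classical_sets cardinality constructive_ereal.

Set Implicit Arguments.
Unset Strict Implicit.
Unset Printing Implicit Defensive.

Import Order.TTheory GRing.Theory Num.Theory.

Local Open Scope classical_set_scope.
Local Open Scope ring_scope.

(** The Nichols algebra is graded by the free abelian group on the letters, and
    everything follows from this grading. The relations are the elements killed
    by all iterated skew derivations followed by the augmentation
    ([nichols_relP]), and the iterated derivation along a word [u] sees only the
    elements of degree [wdeg u]. So the functionals [pairing u] separate the
    points of the Nichols algebra, and each of them vanishes on all homogeneous
    elements outside one degree. Hence nonzero homogeneous elements of distinct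
    degrees are linearly independent ([homogeneous_free]).

    For a Lyndon word [u] the element [super_letter_minus p u] is an iterated
    commutator of letters: it lies in the Nichols Lie algebra and is homogeneous
    of degree [wdeg u]. Choosing one nonzero such element in each degree gives
    the lower bound for the dimension; the subtracted 1 pays for the formal
    degree of zero. Moreover only finitely many words have a given degree, namely
    the rearrangements of one word, so an infinite [D_minus p] has infinitely
    many degrees and forces infinite dimension.

    For the count of degrees, a hard super-letter is produced for each letter
    [i] and for each edge [i < j]. No product of larger super-letters has the
    degree of [[:: i]] or of [[:: i; j]]: the factor containing [i] would be
    [[:: i]] or [[:: i; j]] itself, which is not larger. So hardness amounts to
    not being zero ([hard_by_degree]). On words of length two, [pairing] shows
    that [super_letter p [:: i; j]] is nonzero when [p i j * p j i] is not 1, and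
    that the commutator of the letters [i] and [j] vanishes only when [p i j] and
    [p j i] both are 1. The degrees found are distinct since a sorted word is
    determined by its degree. *)

(** * Dimension *)

Section Dimension.
Variables (F : fieldType) (V : lmodType F).
Implicit Types W : set V.

(** The coordinates of the [m] independent vectors form an [m * k] matrix, and a
    row vector killed by it would be a linear relation: the matrix has rank
    [m]. *)
Lemma has_basis_of_size_ge W (k m : nat) (v : 'I_m -> V) :
  has_basis_of_size W k -> (forall i, W (v i)) ->
  (forall c : 'I_m -> F, \sum_i c i *: v i = 0 -> forall i, c i = 0) ->
  (m <= k)%N.
Proof.
move=> [b [_ _ Wb]] Wv v_free.
have coords (i : 'I_m) : exists a : 'rV[F]_k, v i = \sum_j a 0 j *: b j.
  have [l [c [e [eb ->]]]] := Wb _ (Wv i).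
  have /choice[f fE] : forall s, exists j, e s = b j.
    by move=> s; have [j _ <-] := eb s; exists j.
  exists (\sum_s c s *: delta_mx 0 (f s)).
  under [RHS]eq_bigr => j _.
    rewrite summxE scaler_suml.
    under eq_bigr => s _ do rewrite !mxE eqxx /=.
    over.
  rewrite exchange_big; apply: eq_bigr => s _ /=.
  rewrite (bigD1 (f s)) //= eqxx mulr1 -fE big1 ?addr0 // => j /negPf jf.
  by rewrite jf mulr0 scale0r.
have [a aE] := choice coords.
pose A : 'M[F]_(m, k) := \matrix_(i, j) a i 0 j.
have comb (c : 'rV[F]_m) : \sum_i c 0 i *: v i = \sum_j (c *m A) 0 j *: b j.
  under [RHS]eq_bigr => j _ do rewrite mxE scaler_suml.
  rewrite exchange_big; apply: eq_bigr => i _ /=.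
  rewrite aE scaler_sumr; apply: eq_bigr => j _.
  by rewrite mxE scalerA.
suff : row_free A by move=> /eqP <-; exact: rank_leq_col.
rewrite -kermx_eq0; apply/eqP/row_matrixP => r; rewrite row0; apply/rowP => i.
rewrite [RHS]mxE; apply: (v_free (fun i => row r (kermx A) 0 i)).
rewrite comb (_ : row r (kermx A) *m A = 0); last first.
  by apply/sub_kermxP; exact: row_sub.
by rewrite big1 // => j _; rewrite mxE scale0r.
Qed.

Lemma edim_ge W (m : nat) (v : 'I_m -> V) :
  (forall i, W (v i)) ->
  (forall c : 'I_m -> F, \sum_i c i *: v i = 0 -> forall i, c i = 0) ->
  ((m%:Z)%:E <= edim W)%E.
Proof.
move=> Wv v_free; rewrite /edim; case: asboolP => [[k Wk]|_]; last exact: leey.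
by rewrite lee_fin lez_nat (has_basis_of_size_ge (xgetI 0%N Wk) Wv).
Qed.

Lemma edim_pinfty W : (forall m : nat, (m%:Z)%:E <= edim W)%E -> edim W = +oo%E.
Proof.
rewrite /edim; case: asboolP => // _; set k := xget _ _ => /(_ k.+1).
by rewrite lee_fin lez_nat ltnn.
Qed.

End Dimension.

(** * The grading and the derivation functionals *)

Section Degrees.
Variables (F : fieldType) (n : nat).
Local Notation T := (tensor_alg F n).
Implicit Types (t : T) (u v w : word n) (d : 'rV[int]_n).

Lemma wdeg_cat u v : wdeg (u ++ v) = wdeg u + wdeg v.
Proof. exact: big_cat. Qed.

Lemma wdeg_cons i u : wdeg (i :: u) = delta_mx 0 i + wdeg u.
Proof. exact: big_cons. Qed.

Lemma wdeg_count u i : wdeg u 0 i = (count_mem i u)%:Z.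
Proof.
elim: u => [|j u IHu]; first by rewrite /wdeg big_nil mxE.
by rewrite wdeg_cons mxE IHu mxE eqxx /= [i == j]eq_sym PoszD; case: (j == i).
Qed.

(** The degree of a word is its vector of letter multiplicities. *)
Lemma wdeg_eq u v : (wdeg u == wdeg v) = perm_eq u v.
Proof.
apply/eqP/idP => [uv|/permP uv].
  by apply/allP => i _ /=; rewrite -eqz_nat -!wdeg_count uv.
by apply/rowP => i; rewrite !wdeg_count uv.
Qed.

Definition tens_homogeneous d t : Prop :=
  forall w, FMonom w \in msupp t -> wdeg w = d.

Lemma tens_homogeneous0 d : tens_homogeneous d 0.
Proof. by move=> w; rewrite msupp0. Qed.

Lemma tens_homogeneous_lin d c s t : tens_homogeneous d s ->
  tens_homogeneous d t -> tens_homogeneous d (c *: s + t).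
Proof.
move=> hs ht w; rewrite -mcoeff_neq0 mcoeffD mcoeffZ => st0.
have [/ht //|wt] := boolP (FMonom w \in msupp t).
apply: hs; apply: contraNT st0 => ws.
by rewrite !mcoeff_outdom // mulr0 addr0.
Qed.

Lemma tens_homogeneousZ d c t : tens_homogeneous d t -> tens_homogeneous d (c *: t).
Proof.
move=> ht; rewrite -[c *: t]addr0.
exact/tens_homogeneous_lin/tens_homogeneous0.
Qed.

Lemma tens_homogeneousM d e s t : tens_homogeneous d s ->
  tens_homogeneous e t -> tens_homogeneous (d + e) (s * t).
Proof.
move=> hs ht w /msuppM_le[[v] [[v'] [/hs <- /ht <-]]].
move=> /(congr1 (@fmonom_val _)) /= ->.
by rewrite -[mmul _ _]/(fmmul _ _) fmmulE wdeg_cat.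
Qed.

Lemma tens_homogeneous_word w : tens_homogeneous (wdeg w) (tword F w).
Proof.
move=> v; rewrite -mcoeff_neq0 coef_tword.
by case: (eqVneq w v) => [->|_] //; rewrite eqxx.
Qed.

Variable p : 'M[F]_n.

(** [der p i] removes one occurrence of the letter [i] from a word. *)
Lemma tens_homogeneous_der_word i w :
  tens_homogeneous (wdeg w - delta_mx 0 i) (der_word p i w).
Proof.
elim: w => [|j w IHw] /=; first exact: tens_homogeneous0.
have tail : tens_homogeneous (wdeg (j :: w) - delta_mx 0 i)
    ((p i j)^-1 *: (tword F [:: j] * der_word p i w)).
  apply: tens_homogeneousZ; rewrite -cat1s wdeg_cat -addrA.
  exact/tens_homogeneousM/IHw/tens_homogeneous_word.
case: eqP tail => [->|_] tail; last by rewrite scale0r add0r.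
apply: tens_homogeneous_lin tail.
rewrite wdeg_cons addrC addKr; exact: tens_homogeneous_word.
Qed.

Lemma tens_homogeneous_der d i t :
  tens_homogeneous d t -> tens_homogeneous (d - delta_mx 0 i) (der p i t).
Proof.
move=> ht; rewrite /der /lin_ext big_seq.
elim/big_ind: _ => [|s s' hs hs'|[w] /ht <-]; first exact: tens_homogeneous0.
  by rewrite -[s]scale1r; exact: tens_homogeneous_lin.
exact/tens_homogeneousZ/tens_homogeneous_der_word.
Qed.

(** The functional by which [der_rel] tests membership in the ideal of
    relations. *)
Definition der_pairing u : T -> F^o :=
  fun t => tcoef [::] (foldl (fun s i => der p i s) t u).

Lemma der_pairing_is_linear u : linear (der_pairing u).
Proof.
rewrite /der_pairing; elim: u => [|i u IHu] c s t /=; first exact: linearP.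
by rewrite linearP IHu.
Qed.
HB.instance Definition _ u :=
  GRing.isLinear.Build F T F^o *:%R (der_pairing u) (der_pairing_is_linear u).

(** Deriving along [u] lowers the degree by [wdeg u], and the augmentation kills
    every degree other than 0. *)
Lemma der_pairing_degree d u t :
  tens_homogeneous d t -> wdeg u <> d -> der_pairing u t = 0.
Proof.
rewrite /der_pairing; elim: u d t => [|i u IHu] d t ht ud /=.
  by apply: mcoeff_outdom; apply/negP => /ht.
apply: (IHu (d - delta_mx 0 i)); first exact: tens_homogeneous_der.
by move=> ud'; apply: ud; rewrite wdeg_cons ud' addrC subrK.
Qed.

Lemma nichols_pi_eq0 t : nichols_pi p t = 0 <-> forall u, der_pairing u t = 0.
Proof.
rewrite -(linear0 (nichols_pi p)); split.
  by move/nichols_pi_eq; rewrite subr0 => /nichols_relP.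
by move=> t0; apply/nichols_pi_eq; rewrite subr0; apply/nichols_relP.
Qed.

Local Notation B := (nichols p).

(** It descends to the Nichols algebra because [der_pairing] kills the relations
    ([pairing_pi]); [nichols_repr] picks an arbitrary lift. *)
Definition pairing u (b : B) : F := der_pairing u (nichols_repr b).

Lemma pairing_pi u t : pairing u (nichols_pi p t) = der_pairing u t.
Proof.
apply/eqP; rewrite -subr_eq0 -linearB; apply/eqP.
by move: u; apply/nichols_relP; exact: nichols_reprE.
Qed.

Lemma pairing_is_linear u : linear (pairing u : B -> F^o).
Proof.
move=> c a b; rewrite -[a]nichols_reprK -[b]nichols_reprK.
by rewrite -linearP !pairing_pi linearP.
Qed.
HB.instance Definition _ u :=
  GRing.isLinear.Build F B F^o *:%R (pairing u : B -> F^o) (pairing_is_linear u).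

Lemma pairing_subZ u c (a b : B) :
  pairing u (a - c *: b) = pairing u a - c * pairing u b.
Proof. by rewrite -scaleNr addrC linearP /= addrC /GRing.scale /= mulNr. Qed.

Lemma pairing_eq0 (b : B) : (forall u, pairing u b = 0) -> b = 0.
Proof. by move=> b0; rewrite -[b]nichols_reprK; apply/nichols_pi_eq0. Qed.

Lemma pairing_degree d u (b : B) :
  homogeneous d b -> wdeg u <> d -> pairing u b = 0.
Proof. by case=> t ht ->; rewrite pairing_pi; exact: der_pairing_degree. Qed.

Lemma homogeneous_wdeg d (b : B) :
  homogeneous d b -> b <> 0 -> exists2 u, wdeg u = d & pairing u b != 0.
Proof.
move=> hb b0; have [u u0] : exists u, pairing u b != 0.
  apply: contrapT => no; apply/b0/pairing_eq0 => u.
  by apply/eqP/negPn/negP => u0; apply: no; exists u.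
by exists u => //; apply: contrapT => /(pairing_degree hb)/eqP; exact/negP.
Qed.

Lemma homogeneous_unique d e (b : B) :
  homogeneous d b -> homogeneous e b -> b <> 0 -> d = e.
Proof.
move=> hd he b0; have [u <- u0] := homogeneous_wdeg hd b0.
by apply: contrapT => /(pairing_degree he)/eqP; exact/negP.
Qed.

Lemma homogeneous0 d : homogeneous d (0 : B).
Proof. by exists 0; rewrite ?linear0 //; exact: tens_homogeneous0. Qed.

Lemma homogeneous_lin d c (a b : B) :
  homogeneous d a -> homogeneous d b -> homogeneous d (c *: a + b).
Proof.
move=> [s hs ->] [t ht ->]; exists (c *: s + t); last by rewrite linearP.
exact: tens_homogeneous_lin.
Qed.

Lemma homogeneous_subZ d c (a b : B) :
  homogeneous d a -> homogeneous d b -> homogeneous d (a - c *: b).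
Proof. by move=> ha hb; rewrite addrC -scaleNr; exact: homogeneous_lin. Qed.

Lemma homogeneousM d e (a b : B) :
  homogeneous d a -> homogeneous e b -> homogeneous (d + e) (a * b).
Proof.
move=> [s hs ->] [t ht ->]; exists (s * t); last by rewrite rmorphM.
exact: tens_homogeneousM.
Qed.

Lemma homogeneous_x i : homogeneous (wdeg [:: i]) (nichols_x p i).
Proof. by exists (tword F [:: i]) => //; exact: tens_homogeneous_word. Qed.

(** The functional detecting [b i] annihilates the other terms of a linear
    relation, so it isolates the coefficient of [b i]. *)
Lemma homogeneous_free m (d : 'I_m -> 'rV[int]_n) (b : 'I_m -> B) :
  injective d -> (forall i, homogeneous (d i) (b i)) -> (forall i, b i <> 0) ->
  forall c : 'I_m -> F, \sum_i c i *: b i = 0 -> forall i, c i = 0.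
Proof.
move=> d_inj hb b0 c cb0 i; have [u ud ub] := homogeneous_wdeg (hb i) (b0 i).
have := congr1 (pairing u) cb0.
rewrite linear0 linear_sum (bigD1 i) //= big1 => [|j ji]; last first.
  rewrite linearZ /= (pairing_degree (hb j)) ?scaler0 //.
  by rewrite ud => /d_inj ij; rewrite ij eqxx in ji.
by rewrite addr0 linearZ /= => /eqP; rewrite mulf_eq0 (negPf ub) orbF => /eqP.
Qed.

End Degrees.

Arguments pairing {F n} p u b.

(** * Super-letters and hardness *)

Section SuperLetters.
Variables (F : fieldType) (n : nat) (p : 'M[F]_n).
Local Notation B := (nichols p).
Implicit Types (u v w : word n) (i j : 'I_n).

(** The recursion scheme of [bracketing]. *)
Lemma word_size_ind (P : word n -> Prop) :
  P [::] -> (forall i, P [:: i]) ->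
  (forall u, (1 < size u)%N -> P (take (shirshov_index u) u) ->
     P (drop (shirshov_index u) u) -> P u) ->
  forall u, P u.
Proof.
move=> P0 P1 PS u; have [m] := ubnP (size u); elim: m u => // m IHm [|i [|j u]] //.
set v := [:: i, j & u] => sv.
have /andP[s0 s1] := @shirshov_index_bounds _ v isT.
apply: PS => //; apply: IHm.
  by rewrite size_takel ?(ltnW s1) //; exact: leq_trans s1 sv.
by rewrite size_drop; apply: leq_trans (_ : size v <= m)%N; rewrite // ltn_subrL s0.
Qed.

Lemma homogeneous_super_letter u : homogeneous (wdeg u) (super_letter p u).
Proof.
elim/word_size_ind: u => [|i|u su IHv IHw]; first exact: homogeneous0.
  exact: homogeneous_x.
rewrite /super_letter bracketing_cat // -!/(super_letter p _).
rewrite -{1}[u](cat_take_drop (shirshov_index u)) wdeg_cat.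
by apply: homogeneous_subZ; [rewrite addrC|]; exact: homogeneousM.
Qed.

Lemma homogeneous_super_letter_minus u :
  homogeneous (wdeg u) (super_letter_minus p u).
Proof.
elim/word_size_ind: u => [|i|u su IHv IHw]; first exact: homogeneous0.
  exact: homogeneous_x.
rewrite /super_letter_minus bracketing_cat // -!/(super_letter_minus p _).
rewrite -{1}[u](cat_take_drop (shirshov_index u)) wdeg_cat /lie_bracket.
rewrite -[X in _ - X]scale1r.
by apply: homogeneous_subZ; [rewrite addrC|]; exact: homogeneousM.
Qed.

Lemma nichols_lie_x i : nichols_lie p (nichols_x p i).
Proof.
move=> L [_]; apply; exists 1%N, (fun=> 1), (fun=> nichols_x p i).
by split=> [_|]; [exists i | rewrite big_ord1 scale1r].
Qed.

Lemma nichols_lie_super_letter_minus u : nichols_lie p (super_letter_minus p u).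
Proof.
elim/word_size_ind: u => [|i|u su IHv IHw]; first by move=> L [[]].
  exact: nichols_lie_x.
rewrite /super_letter_minus bracketing_cat // -!/(super_letter_minus p _).
move=> L hL; have [[_ _ closed] _] := hL.
by apply: closed; [exact: IHw | exact: IHv].
Qed.

Lemma homogeneous_prod us :
  homogeneous (wdeg (flatten us)) (\prod_(v <- us) super_letter p v).
Proof.
elim: us => [|u us IHus] /=.
  rewrite big_nil; exists (tword F [::]); last by rewrite tword_nil rmorph1.
  exact: tens_homogeneous_word.
rewrite big_cons wdeg_cat; apply: homogeneousM IHus.
exact: homogeneous_super_letter.
Qed.

(** Being homogeneous, a nonzero [super_letter p u] is detected by a functional
    [pairing w] with [wdeg w = wdeg u], and this functional kills the products of
    all other degrees. *)
Lemma hard_by_degree u : lyndon u -> super_letter p u <> 0 ->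
  (forall us, all (fun v => lyndon v && word_lt u v) us ->
     ~~ perm_eq (flatten us) u) ->
  hard p u.
Proof.
move=> Lu u0 not_u; split=> // -[k [c [b [bP ub]]]].
have [w wu w0] := homogeneous_wdeg (homogeneous_super_letter u) u0.
case/eqP: w0; rewrite ub linear_sum big1 // => s _.
rewrite linearZ /=; have [us /not_u us_u <-] := bP s.
rewrite (pairing_degree (homogeneous_prod us)) ?scaler0 //.
by rewrite wu => /esym/eqP; rewrite wdeg_eq; exact/negP.
Qed.

Lemma pairing_x i : pairing p [:: i] (nichols_x p i) = 1.
Proof.
rewrite pairing_pi /der_pairing /= der_cons eqxx der_nil mulr0 scaler0 addr0.
by rewrite scale1r tcoef_word.
Qed.

Lemma nichols_x_neq0 i : nichols_x p i <> 0.
Proof.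
by move=> x0; have /eqP := pairing_x i; rewrite x0 linear0 eq_sym oner_eq0.
Qed.

Lemma word_lt_nil u : word_lt u [::] = false.
Proof. exact: ltxis0. Qed.

Lemma word_lt_cons i j u v :
  word_lt (i :: u) (j :: v) = (i < j)%N || (i == j) && word_lt u v.
Proof.
rewrite /word_lt ltxi_cons !leEord -val_eqE /=.
by case: ltngtP.
Qed.

Lemma hard_letter i : hard p [:: i].
Proof.
apply: hard_by_degree => // [|us us_i]; first exact: nichols_x_neq0.
apply/negP => /(perm_small_eq (isT : size [:: i] <= 1)%N).
case: us us_i => [|v us] //=.
case/andP => /andP[Lv lt_iv] _.
case: v Lv lt_iv => [|j v] //= _ lt_iv [ji]; move: lt_iv.
by rewrite ji word_lt_cons ltnn eqxx; case: v => //; rewrite word_lt_nil.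
Qed.

Lemma der_letter i j : der p i (tword F [:: j]) = (i == j)%:R *: tword F [::].
Proof. by rewrite der_cons der_nil mulr0 scaler0 addr0. Qed.

Lemma der_letters i j k : der p k (tword F [:: i; j]) =
  (k == i)%:R *: tword F [:: j] + ((p k i)^-1 * (k == j)%:R) *: tword F [:: i].
Proof. by rewrite der_cons der_letter mul_tensr twordM scalerA. Qed.

Lemma der_pairing_letter i l (c : F) :
  der_pairing p [:: l] (c *: tword F [:: i]) = c * (l == i)%:R.
Proof.
have -> : der_pairing p [:: l] (c *: tword F [:: i]) =
    c * der_pairing p [:: l] (tword F [:: i]).
  exact: linearZ.
have -> : der_pairing p [:: l] (tword F [:: i]) =
    tcoef [::] (der p l (tword F [:: i])) by [].
by rewrite der_letter /tcoef mcoeffZ coef_tword mulr1.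
Qed.

(** The second term comes from the skew Leibniz rule: deriving the second letter
    [j] by [k] moves past [i] at the cost of [(p k i)^-1]. *)
Lemma pairing_letters i j k l :
  pairing p [:: k; l] (nichols_x p i * nichols_x p j) =
  (k == i)%:R * (l == j)%:R + (p k i)^-1 * (k == j)%:R * (l == i)%:R.
Proof.
have -> : nichols_x p i * nichols_x p j = nichols_pi p (tword F [:: i; j]).
  by rewrite -(twordM F [:: i] [:: j]) rmorphM.
rewrite pairing_pi.
rewrite -[LHS]/(der_pairing p [:: l] (der p k (tword F [:: i; j]))).
by rewrite der_letters linearD; congr (_ + _); exact: der_pairing_letter.
Qed.

Lemma pairing_brackets c i j k l :
  pairing p [:: k; l]
    (nichols_x p j * nichols_x p i - c *: (nichols_x p i * nichols_x p j)) =
  (k == j)%:R * (l == i)%:R + (p k j)^-1 * (k == i)%:R * (l == j)%:R -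
    c * ((k == i)%:R * (l == j)%:R + (p k i)^-1 * (k == j)%:R * (l == i)%:R).
Proof. by rewrite pairing_subZ; congr (_ - _ * _); exact: pairing_letters. Qed.

Lemma lyndon2 i j : lyndon [:: i; j] = (i < j)%N.
Proof.
rewrite /lyndon /= !word_lt_cons word_lt_nil !andbF orbF andbT.
by rewrite -val_eqE /=; case: ltngtP.
Qed.

Lemma bichar_letters i j : bichar p (wdeg [:: i]) (wdeg [:: j]) = p i j.
Proof.
rewrite /bichar /wdeg !big_seq1 (bigD1 i) //= (bigD1 j) //= !mxE !eqxx /= mul1r.
rewrite big1 => [|k /negPf kj]; last by rewrite mxE kj andbF mulr0 expr0z.
rewrite big1 ?mulr1 ?expr1z // => k /negPf ki.
by rewrite big1 // => l _; rewrite !mxE ki mul0r expr0z.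
Qed.

Lemma bracketing2 (br : word n -> word n -> B -> B -> B) i j :
  bracketing br [:: i; j] = br [:: i] [:: j] (nichols_x p i) (nichols_x p j).
Proof.
have ij1 : shirshov_index [:: i; j] = 1%N by [].
by rewrite bracketing_cat // ij1.
Qed.

Lemma super_letter2 i j : super_letter p [:: i; j] =
  nichols_x p j * nichols_x p i - p j i *: (nichols_x p i * nichols_x p j).
Proof. by rewrite /super_letter bracketing2 bichar_letters. Qed.

(** The scalar 1 gives the commutator the shape of [pairing_brackets]. *)
Lemma super_letter_minus2 i j : super_letter_minus p [:: i; j] =
  nichols_x p j * nichols_x p i - 1 *: (nichols_x p i * nichols_x p j).
Proof. by rewrite scale1r /super_letter_minus bracketing2. Qed.

Hypothesis p_neq0 : forall i j, p i j != 0.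

(** Pairing with [[:: i; j]] gives [(p i j)^-1 - p j i], which is nonzero on an
    edge. *)
Lemma super_letter_edge_neq0 i j :
  dynkin_edge p i j -> super_letter p [:: i; j] <> 0.
Proof.
case/andP => /negPf ij pij u0; move: pij.
have ji : (j == i) = false by rewrite eq_sym.
have : (p i j)^-1 - p j i = 0.
  transitivity (pairing p [:: i; j] (super_letter p [:: i; j])).
    rewrite super_letter2 pairing_brackets !eqxx ij ji.
    by rewrite !mul0r !mulr0 !mulr1 add0r addr0 mulr1.
  by rewrite u0 linear0.
move/eqP; rewrite subr_eq0 => /eqP <-.
by rewrite mulfV ?eqxx.
Qed.

(** Pairing with [[:: i; j]] and [[:: j; i]] gives [(p i j)^-1 - 1] and
    [1 - (p j i)^-1]; both vanish only if [p i j * p j i = 1]. *)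
Lemma super_letter_minus_edge_neq0 i j :
  dynkin_edge p i j -> super_letter_minus p [:: i; j] <> 0.
Proof.
case/andP => /negPf ij /negP edge u0; apply: edge.
have ji : (j == i) = false by rewrite eq_sym.
have pair0 w : pairing p w (super_letter_minus p [:: i; j]) = 0 :> F.
  by rewrite u0 linear0.
have pij : p i j = 1.
  have := pair0 [:: i; j].
  rewrite super_letter_minus2 pairing_brackets !eqxx ij ji.
  rewrite !mul0r !mulr0 !mulr1 add0r addr0 mulr1 => /eqP.
  by rewrite subr_eq0 => /eqP; rewrite -[1 in RHS]invr1 => /invr_inj.
have pji : p j i = 1.
  have := pair0 [:: j; i].
  rewrite super_letter_minus2 pairing_brackets !eqxx ij ji.
  rewrite !mul0r !mulr0 !mulr1 add0r addr0 mul1r => /eqP.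
  by rewrite subr_eq0 => /eqP; rewrite -[1 in LHS]invr1 => /invr_inj/esym.
by rewrite pij pji mulr1 eqxx.
Qed.

(** The word of a factor in a product of degree [wdeg [:: i; j]] has at most one
    [i], at most one [j] and no other letter. If it is Lyndon and contains the
    smaller letter [i], it is [[:: i]] or [[:: i; j]], and neither exceeds
    [[:: i; j]]. *)
Lemma hard_edge i j : (i < j)%N -> dynkin_edge p i j -> hard p [:: i; j].
Proof.
move=> lt_ij ij; apply: hard_by_degree; first by rewrite lyndon2.
  exact: super_letter_edge_neq0.
move=> us us_u; apply/negP => uP.
have i_us : i \in flatten us by rewrite (perm_mem uP) mem_head.
have /flattenP[v v_us i_v] := i_us.
have /andP[Lv lt_uv] := allP us_u _ v_us.
have vE k : k \in v -> (k == i) || (k == j).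
  by move=> kv; rewrite -mem_seq2 -(perm_mem uP); apply/flattenP; exists v.
have : (size v <= 2)%N.
  have <- : size (flatten us) = 2%N by exact: perm_size uP.
  case/splitPr: v_us => s1 s2.
  by rewrite flatten_cat /= !size_cat addnCA leq_addr.
case: v Lv lt_uv vE i_v {v_us} => [|a [|b [|c v]]] // Lv lt_uv vE i_v _.
  move: i_v; rewrite mem_seq1 => /eqP ia.
  by move: lt_uv; rewrite ia word_lt_cons ltnn word_lt_nil andbF.
move: Lv; rewrite lyndon2 => ab.
have /orP[/eqP ai|/eqP aj] := vE a (mem_head _ _); last first.
  move: i_v; rewrite mem_seq2 aj => /orP[] /eqP ib.
    by move: lt_ij; rewrite ib ltnn.
  by move: ab; rewrite aj -ib => /(ltn_trans lt_ij); rewrite ltnn.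
have bj : b = j.
  have /orP[/eqP bi|/eqP //] : (b == i) || (b == j).
    by apply: vE; rewrite !inE eqxx orbT.
  by move: ab; rewrite ai bi ltnn.
by move: lt_uv; rewrite ai bj !word_lt_cons !ltnn word_lt_nil !andbF.
Qed.

End SuperLetters.

(** * The degrees of the hard commutators *)

Section DegreesOfD.
Variables (F : fieldType) (n : nat) (p : 'M[F]_n).
Local Notation degs := (deg_D_minus p).
Local Open Scope ereal_scope.

Lemma has_degree_super_letter_minus (u : word n) d :
  has_degree (super_letter_minus p u) (Some d) -> d = wdeg u.
Proof.
move=> [u0 hd]; apply: homogeneous_unique hd _ u0.
exact: homogeneous_super_letter_minus.
Qed.

Lemma deg_D_minus_hard (u : word n) :
  hard p u -> super_letter_minus p u <> 0%R -> degs (Some (wdeg u)).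
Proof.
by move=> hu u0; exists u => //; split=> //; exact: homogeneous_super_letter_minus.
Qed.

Lemma edim_nichols_lie_ge (X : {fset 'rV[int]_n}) :
  (forall d, d \in X -> degs (Some d)) ->
  (#|` X|%:Z)%:E <= edim (nichols_lie p).
Proof.
move=> XD; have : forall d : X, exists u,
    hard p u /\ has_degree (super_letter_minus p u) (Some (val d)).
  by move=> d; have [u hu du] := XD _ (valP d); exists u.
case/choice => u uP; rewrite cardfE.
pose v (i : 'I_#|{: X}|) := enum_val i.
apply: (edim_ge (v := fun i => super_letter_minus p (u (v i)))).
  by move=> i; exact: nichols_lie_super_letter_minus.
apply: (homogeneous_free (d := fun i => val (v i))).
- by move=> i j /val_inj/enum_val_inj.
- by move=> i; have [_ []] := uP (v i).
- by move=> i; have [_ []] := uP (v i).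
Qed.

Lemma edim_nichols_lie_pinfty :
  infinite_set degs -> edim (nichols_lie p) = +oo.
Proof.
move=> degs_inf; apply: edim_pinfty => m.
have someD : infinite_set (Some @^-1` degs).
  move=> someD; apply: degs_inf.
  apply: (@sub_finite_set _ _ ([set None] `|` Some @` (Some @^-1` degs))).
    by move=> [d|] dD; [right; exists d | left].
  by rewrite finite_setU; split; [exact: finite_set1 | exact: finite_image].
have [X XD mX] := infinite_set_fset m someD.
apply: le_trans (edim_nichols_lie_ge (X := X) _); last by move=> d /XD.
by rewrite lee_fin lez_nat.
Qed.

(** Only finitely many words, rearrangements of each other, share a degree, so
    finitely many degrees leave room for finitely many commutators. *)
Lemma infinite_deg_D_minus : infinite_set (D_minus p) -> infinite_set degs.
Proof.
apply: contra_not => degs_fin.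
pose fiber o :=
  [set b | exists2 u, hard p u & b = super_letter_minus p u /\ has_degree b o].
apply: (@sub_finite_set _ _ (\bigcup_(o in degs) fiber o)).
  move=> b [u hu <-].
  have [u0|u0] := pselect (super_letter_minus p u = 0%R).
    by exists None; exists u.
  exists (Some (wdeg u)); first exact: deg_D_minus_hard.
  by exists u => //; do 2?split=> //; exact: homogeneous_super_letter_minus.
apply: bigcup_finite => // -[d|] _; last first.
  by apply: (sub_finite_set _ (finite_set1 0%R)) => b [u _ []].
have [[u ud]|no] := pselect (exists u : word n, wdeg u = d); last first.
  apply: (sub_finite_set _ (finite_set0 _)) => b [u _ [->]].
  by move/has_degree_super_letter_minus => du; apply: no; exists u.
apply: (sub_finite_set _
  (finite_image (super_letter_minus p) (finite_seq (permutations u)))).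
move=> b [w _ [-> /has_degree_super_letter_minus]]; rewrite -ud => uw.
by exists w => //=; rewrite mem_permutations -wdeg_eq uw.
Qed.

Lemma ecard_deg_D_minus_le : ecard degs - 1%:E <= edim (nichols_lie p).
Proof.
have [degs_fin|/edim_nichols_lie_pinfty ->] := pselect (finite_set degs);
  last exact: leey.
have X_fin : finite_set (Some @^-1` degs).
  by apply: finite_preimage => // d e _ _ [].
(* [None], the degree of zero, is the only degree outside the image of [X]. *)
pose X := fset_set (Some @^-1` degs).
have X_le : (#|` fset_set degs| <= #|` X|.+1)%N.
  apply: leq_trans (_ : #|` None |` Some @` X|%fset <= _)%N; last first.
    rewrite cardfsU1 card_imfset => [|d e []] //.
    exact: (leq_add (leq_b1 _) (leqnn _)).
  apply/fsubset_leq_card/fsubsetP => -[d|]; last by rewrite !inE.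
  rewrite in_fset_set // inE => dD; rewrite !inE /=.
  by apply: in_imfset; rewrite /= in_fset_set // inE.
have X_ge := @edim_nichols_lie_ge X.
apply: le_trans (X_ge _); last by move=> d; rewrite in_fset_set // inE.
by rewrite /ecard asboolT // -EFinB lee_fin lerBlDr -PoszD lez_nat addn1.
Qed.

Lemma wdeg_sorted_inj (u v : word n) :
  sorted <=%O u -> sorted <=%O v -> wdeg u = wdeg v -> u = v.
Proof. by move=> su sv /eqP; rewrite wdeg_eq; exact: le_sorted_eq. Qed.

Lemma ecard_deg_D_minus_ge : (forall i j, p i j != 0%R) ->
  (n%:Z + (dynkin_edges p)%:Z)%:E <= ecard degs.
Proof.
move=> p_neq0; rewrite /ecard; case: asboolP => [degs_fin|_]; last exact: leey.
pose edges := [set e : 'I_n * 'I_n | (e.1 < e.2)%N & dynkin_edge p e.1 e.2]%SET.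
pose W : seq (word n) :=
  [seq [:: i] | i <- enum 'I_n] ++ [seq [:: e.1; e.2] | e <- enum edges].
have W_letter_edge u : u \in W -> (exists i, u = [:: i]) \/
    exists i j, [/\ u = [:: i; j], (i < j)%N & dynkin_edge p i j].
  rewrite mem_cat => /orP[/mapP[i _ ->]|/mapP[[i j] + ->]]; first by left; exists i.
  by rewrite mem_enum inE => /andP[]; right; exists i, j.
have W_deg u : u \in W -> degs (Some (wdeg u)).
  case/W_letter_edge => [[i ->]|[i [j [-> ij edge_ij]]]].
    apply: deg_D_minus_hard; first exact: hard_letter.
    exact: nichols_x_neq0.
  apply: deg_D_minus_hard; first exact: hard_edge.
  exact: super_letter_minus_edge_neq0.
have W_sorted u : u \in W -> sorted <=%O u.
  case/W_letter_edge => [[i ->] //|[i [j [-> ij _]]]] /=.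
  by rewrite andbT leEord ltnW.
have W_uniq : uniq W.
  rewrite cat_uniq; apply/and3P; split.
  - by rewrite map_inj_uniq ?enum_uniq // => i j [].
  - by apply/hasPn => _ /mapP[e _ ->]; apply/negP => /mapP[].
  - by rewrite map_inj_uniq ?enum_uniq // => -[i j] [k l] /= [-> ->].
have -> : (n%:Z + (dynkin_edges p)%:Z)%R = (size [seq Some (wdeg u) | u <- W])%:Z.
  by rewrite size_map size_cat !size_map -enumT -!cardE card_ord PoszD.
rewrite lee_fin lez_nat; apply: uniq_leq_size.
  rewrite map_inj_in_uniq // => u v uW vW [].
  by apply: wdeg_sorted_inj; exact: W_sorted.
by move=> _ /mapP[u uW ->]; rewrite in_fset_set // inE; exact: W_deg.
Qed.

End DegreesOfD.

Unset Implicit Arguments.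

Theorem theorem3p2 (F : fieldType) (n : nat) (p : 'M[F]_n)
    (char_F : [pchar F] =i pred0)
    (p_neq0 : forall i j, p i j != 0)
    (p_conn : dynkin_connected p) :
  ((ecard (deg_D_minus p) - 1%:E <= edim (nichols_lie p))%E /\
   ((n%:Z + (dynkin_edges p)%:Z - 1)%:E <= ecard (deg_D_minus p) - 1%:E)%E) /\
  (infinite_set (D_minus p) -> edim (nichols_lie p) = +oo%E).
Proof.
split; first split; first exact: ecard_deg_D_minus_le.
  by rewrite EFinB leeB // ecard_deg_D_minus_ge.
by move=> /infinite_deg_D_minus/edim_nichols_lie_pinfty.
Qed.
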